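(* Let $(J,\langle\cdot,\cdot\rangle)$ be an SKT Hermitian structure on a $2n$-dimensional almost abelian Lie algebra $\mathfrak{g}=\mathbb{R}e_0\ltimes_L\mathbb{R}^{2n-1}$, with $\mu$, $v_0$, $D$ and $a_1,\dots,a_{n-1}$ as in the context. Then $J$ is harmonic if and only if one of the following mutually exclusive conditions holds: (i) $v_0=0$; or (ii) $v_0\neq 0$ and $a_i=0$ for all $i$, that is, $D\in\mathfrak u(n-1)$; moreover, $D$ is singular and $v_0\in\operatorname{Ker}D$. Furthermore, if $\mathfrak g$ is unimodular then: - in case (i), either $\mu=0$ and $D\in\mathfrak u(n-1)$, or $\mu\neq0$ and there exists exactly one $i\in\{1,\dots,n-1\}$ such that $a_i=-\frac{\mu}{2}$; - in case (ii), $\mu=0$.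
   Context: A Lie algebra $\mathfrak{g}$ is almost abelian if it has a codimension one abelian ideal $\mathfrak{u}$; it is unimodular if $\operatorname{Tr}\operatorname{ad}_x=0$ for all $x$. An almost Hermitian structure on a real Lie algebra $\mathfrak g$ is a pair $(J,\langle\cdot,\cdot\rangle)$ with $\langle\cdot,\cdot\rangle$ an inner product and $J:\mathfrak{g}\to\mathfrak{g}$ an endomorphism with $J^2=-\mathrm{I}$ and $\langle J\cdot,J\cdot\rangle=\langle\cdot,\cdot\rangle$. It is Hermitian if $J$ is integrable, i.e. $[X,Y]+J([JX,Y]+[X,JY])-[JX,JY]=0$ for all $X,Y\in\mathfrak g$. A Hermitian structure is SKT if $\partial\overline\partial\omega=0$ for the corresponding left invariant structure on the simply connected Lie group, where $\omega=\langle J\cdot,\cdot\rangle$; equivalently, the torsion 3-form of its Bismut connection is closed. Levi-Civita connection: $2\langle\nabla_XY,Z\rangle=\langle[X,Y],Z\rangle-\langle[Y,Z],X\rangle+\langle[Z,X],Y\rangle$. Rough Laplacian: $(\nabla^*\nabla J)(X)=\sum_i(\nabla^2_{f_i,f_i}J)(X)$ for any orthonormal basis $\{f_i\}$ of $\mathfrak g$, where $(\nabla^2_{U,V}J)(W)=(\nabla_U(\nabla_VJ))(W)-(\nabla_{\nabla_UV}J)(W)$. $J$ is harmonic if $[J,\nabla^*\nabla J]=0$ on $\mathfrak g$. Notation: fix a codimension one abelian ideal $\mathfrak u$ and a unit vector $e_0$ orthogonal to $\mathfrak u$, and let $L=\operatorname{ad}_{e_0}|_{\mathfrak u}$, so $\mathfrak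 g=\mathbb{R}e_0\ltimes_L\mathfrak u$, $\mathfrak u\cong\mathbb{R}^{2n-1}$. Put $e_1=Je_0\in\mathfrak u$, $\mathfrak a=\mathfrak u\cap J\mathfrak u$ (of dimension $2n-2$, the orthogonal complement of $\mathrm{span}\{e_0,e_1\}$), $J'=J|_{\mathfrak a}$. With respect to $\mathfrak u=\mathbb{R}e_1\oplus\mathfrak a$ write $L=\begin{bmatrix}\mu & w_0^t \\ v_0 & D\end{bmatrix}$ with $\mu\in\mathbb R$, $v_0,w_0\in\mathfrak a$, $D\in\mathfrak{gl}(\mathfrak a)$, that is, $Le_1=\mu e_1+v_0$ and $Lx=\langle w_0,x\rangle e_1+Dx$ for $x\in\mathfrak a$. Let $\mathfrak u(n-1)=\{X\in\mathfrak{gl}(\mathfrak a):[X,J']=0,\ X^t=-X\}$. Known characterization (Arroyo–Lafuente): a Hermitian structure $(J,\langle\cdot,\cdot\rangle)$ on a $2n$-dimensional almost abelian Lie algebra $\mathfrak g=\mathbb{R}e_0\ltimes_L\mathbb{R}^{2n-1}$, with $L=\begin{bmatrix}\mu & w_0^t \\ v_0 & D\end{bmatrix}$ with respect to $\mathfrak u=\mathbb{R}e_1\oplus\mathfrak a$, is SKT if and only if $w_0=0$, $[D,J']=0$, $[D,D^t]=0$ and each eigenvalue of $D$ has real part equal to $0$ or $-\frac\mu2$. Consequently, in the SKT case there is an orthonormal basis $\{e_2,\dots,e_{2n-1}\}$ of $\mathfrak a$ in which $J'$ is block diagonal with $n-1$ blocks $\begin{bmatrix}0 & -1 \\ 1 &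 0\end{bmatrix}$ and $D$ is block diagonal with blocks $\begin{bmatrix}a_i & -b_i \\ b_i & a_i\end{bmatrix}$, $1\le i\le n-1$, where $a_i\in\{0,-\frac\mu2\}$ and $b_i\in\mathbb R$. The numbers $a_i$ in the claim are those of such a basis. *)

(* Defs.v *)
From HB Require Import structures.
From mathcomp Require Import all_boot all_order all_algebra.
From mathcomp Require Import sesquilinear complex.
From mathcomp Require Import boolp classical_sets reals.

Set Implicit Arguments.
Unset Strict Implicit.
Unset Printing Implicit Defensive.

Import GRing.Theory Num.Theory.
Local Open Scope ring_scope.

Section LieAlgebra.
Variables (R : realType) (g : vectType R) (br : {bilinear g -> g -> g}).
Implicit Types (x y z : g) (u : {vspace g}).

Definition is_lie_bracket : Prop :=
  (forall x, br x x = 0) /\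
  (forall x y z, br x (br y z) + br y (br z x) + br z (br x y) = 0).

Definition codim1_abelian_ideal u : Prop :=
  [/\ (\dim u).+1 = \dim {:g},
      (forall x y, y \in u -> br x y \in u) &
      {in u &, forall x y, br x y = 0}].

Definition unimodular : Prop :=
  forall x, \tr (passmx.mxof (vbasis {:g}) (vbasis {:g}) (linfun (br x))) = 0.

End LieAlgebra.

Section HermitianStructure.
Variables (R : realType) (g : vectType R) (br : {bilinear g -> g -> g}).
Variables (ip : {dot g for idfun}) (J : 'End(g)).
Implicit Types (X Y Z U V W : g).

Definition almost_hermitian : Prop :=
  (forall X, J (J X) = - X) /\ (forall X Y, ip (J X) (J Y) = ip X Y).

Definition integrable : Prop :=
  forall X Y, br X Y + J (br (J X) Y + br X (J Y)) - br (J X) (J Y) = 0.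

Definition hermitian : Prop := almost_hermitian /\ integrable.

(* Left-invariant complex-valued forms on the simply connected group are
   R-multilinear alternating maps g^k -> R[i]; on these the exterior
   derivative is the Chevalley-Eilenberg differential. *)

Definition dform2 (a : g -> g -> R[i]) X Y Z : R[i] :=
  - a (br X Y) Z + a (br X Z) Y - a (br Y Z) X.

Definition dform3 (a : g -> g -> g -> R[i]) X Y Z W : R[i] :=
  - a (br X Y) Z W + a (br X Z) Y W - a (br X W) Y Z
  - a (br Y Z) X W + a (br Y W) X Z - a (br Z W) X Y.

(* Precomposition of an R-linear map f : g -> R[i], extended C-linearly to
   the complexification of g, with the projections onto its (1,0) and (0,1)
   parts X |-> (X -+ i J X) / 2. *)
Definition p10 (f : g -> R[i]) X : R[i] := (f X - 'i%C * f (J X)) / 2.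
Definition p01 (f : g -> R[i]) X : R[i] := (f X + 'i%C * f (J X)) / 2.

Definition on3 (p q r : (g -> R[i]) -> g -> R[i])
    (a : g -> g -> g -> R[i]) X Y Z : R[i] :=
  p (fun X' => q (fun Y' => r (fun Z' => a X' Y' Z') Z) Y) X.

Definition on4 (p q r s : (g -> R[i]) -> g -> R[i])
    (a : g -> g -> g -> g -> R[i]) X Y Z W : R[i] :=
  p (fun X' => q (fun Y' => r (fun Z' => s (fun W' => a X' Y' Z' W') W) Z) Y) X.

(* Type components: one term for each choice of the slots of type (1,0). *)
Definition part12 a X Y Z : R[i] :=
  on3 p10 p01 p01 a X Y Z + on3 p01 p10 p01 a X Y Z + on3 p01 p01 p10 a X Y Z.

Definition part22 a X Y Z W : R[i] :=
    on4 p10 p10 p01 p01 a X Y Z W + on4 p10 p01 p10 p01 a X Y Z W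
  + on4 p10 p01 p01 p10 a X Y Z W + on4 p01 p10 p10 p01 a X Y Z W
  + on4 p01 p10 p01 p10 a X Y Z W + on4 p01 p01 p10 p10 a X Y Z W.

Definition omega X Y : R[i] := (ip (J X) Y)%:C%C.

(* omega has type (1,1), so its dbar is the (1,2) part of d omega, and the
   del of that is the (2,2) part of its differential. *)
Definition dbar_omega : g -> g -> g -> R[i] := part12 (dform2 omega).
Definition ddbar_omega : g -> g -> g -> g -> R[i] :=
  part22 (dform3 dbar_omega).

Definition skt : Prop :=
  hermitian /\ (forall X Y Z W, ddbar_omega X Y Z W = 0).

(* The vector determined by the Koszul formula; it exists and is unique as
   ip is nondegenerate, so the default value 0 is never used. *)
Definition levi_civita X Y : g :=
  xget 0 [set V | forall Z,
    2 * ip V Z = ip (br X Y) Z - ip (br Y Z) X + ip (br Z X) Y]%classic.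

Definition nabla_end U (A : g -> g) W : g :=
  levi_civita U (A W) - A (levi_civita U W).

Definition nabla2J U V W : g :=
  nabla_end U (nabla_end V J) W - nabla_end (levi_civita U V) J W.

Definition orthonormal_basis (U : {vspace g}) (f : seq g) : Prop :=
  basis_of U f /\ orthonormal ip f.

Definition rough_laplacianJ (f : seq g) X : g := \sum_(v <- f) nabla2J v v X.

Definition harmonic : Prop :=
  forall f, orthonormal_basis fullv f ->
  forall X, J (rough_laplacianJ f X) = rough_laplacianJ f (J X).

End HermitianStructure.

Section AlmostAbelian.
Variables (R : realType) (g : vectType R) (br : {bilinear g -> g -> g}).
Variables (ip : {dot g for idfun}) (J : 'End(g)).

Definition Jcore (u : {vspace g}) : {vspace g} := (u :&: (J @: u))%VS.

(* Endomorphisms of a = Jcore u are represented by endomorphisms D of g preserving a;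
   the values of D outside a are irrelevant. *)
Definition block_form (u : {vspace g}) (e0 : g)
    (mu : R) (v0 w0 : g) (D : 'End(g)) : Prop :=
  let a := Jcore u in let e1 := J e0 in
  [/\ v0 \in a, w0 \in a, (D @: a <= a)%VS,
      br e0 e1 = mu *: e1 + v0 &
      {in a, forall x, br e0 x = ip w0 x *: e1 + D x}].

Definition in_unitary (a : {vspace g}) (D : 'End(g)) : Prop :=
  [/\ (D @: a <= a)%VS,
      {in a, forall x, D (J x) = J (D x)} &
      {in a &, forall x y, ip (D x) y = - ip x (D y)}].

Definition singular_on (a : {vspace g}) (D : 'End(g)) : Prop :=
  (lker D :&: a)%VS != 0%VS.

(* The basis e_2, ..., e_(2n-1) is e = [:: e`_0; ...; e`_(2n-3)], the i-th
   block acting on e`_(2i), e`_(2i+1) for 0 <= i < n-1; the columns of each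
   2x2 block are the images of these two vectors. *)
Definition normal_form_basis (n : nat) (a : {vspace g}) (mu : R)
    (D : 'End(g)) (e : seq g) (ra rb : 'I_n.-1 -> R) : Prop :=
  orthonormal_basis ip a e /\
  forall i : 'I_n.-1,
    let x := e`_(2 * i) in let y := e`_((2 * i).+1) in
    [/\ J x = y /\ J y = - x,
        D x = ra i *: x + rb i *: y,
        D y = - rb i *: x + ra i *: y &
        ra i = 0 \/ ra i = - (mu / 2)].

End AlmostAbelian.

(* Main.v *)
Require Import Defs.
From mathcomp Require Import all_boot all_order all_algebra.
From mathcomp Require Import sesquilinear complex spectral ring lra.
From mathcomp Require Import boolp classical_sets reals.

(* Put L = ad e0 and let A, P be its symmetric and skew parts. The Koszul
   formula gives nabla_X Y = <X,e0> P Y + <A X,Y> e0 - <Y,e0> A X, and summing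
   over an orthonormal basis turns the harmonicity of J into an identity between
   A, P and J that reduces to D v0 = (tr D) v0.

   The imaginary part of ddbar omega at (e0, e1, x, y) gives the equation
   mu (D + D^t) + D^2 + 2 D^t D + (D^t)^2 = 0 on a. Put B = D + D^t; the equation
   says that G = mu B + B^2 is a commutator of D and B, and G commutes with B, so
   tr(G^2) = 0 and G = 0: D is normal, hence unitarily diagonalizable.
   Evaluating the equation at an eigenvector with eigenvalue l + i b gives
   2 l (2 l + mu) = 0.

   If v0 <> 0 and D v0 = (tr D) v0, then tr D is such an l. Since tr D = - k mu
   with k the number of i such that a_i <> 0, mu k (2 k - 1) = 0, so mu = 0 or
   k = 0; in both cases all a_i vanish. *)

Set Implicit Arguments.
Unset Strict Implicit.
Unset Printing Implicit Defensive.

Import Order.TTheory GRing.Theory Num.Theory.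
Local Open Scope ring_scope.

(** * Orthonormal bases *)

Section Euclidean.
Variables (R : realType) (g : vectType R) (ip : {dot g for idfun}).
Implicit Types (x y z : g) (U : {vspace g}) (f s : seq g).

Lemma ipC x y : ip x y = ip y x.
Proof. by rewrite hermC expr0 mul1r. Qed.

Lemma ipDl x y z : ip (x + y) z = ip x z + ip y z.
Proof. exact: linearDl. Qed.
Lemma ipDr x y z : ip z (x + y) = ip z x + ip z y.
Proof. exact: linearDr. Qed.
Lemma ipNl x z : ip (- x) z = - ip x z.
Proof. exact: linearNl. Qed.
Lemma ipNr x z : ip z (- x) = - ip z x.
Proof. exact: linearNr. Qed.
Lemma ipZl c x z : ip (c *: x) z = c * ip x z.
Proof. exact: linearZl_LR. Qed.
Lemma ipZr c x z : ip z (c *: x) = c * ip z x.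
Proof. exact: linearZr_LR. Qed.
Lemma ip0l x : ip 0 x = 0.
Proof. exact: linear0l. Qed.
Lemma ip0r x : ip x 0 = 0.
Proof. exact: linear0r. Qed.
Definition ipE := (ipDl, ipDr, ipNl, ipNr, ipZl, ipZr, ip0l, ip0r).

Lemma ip_suml I (r : seq I) (F : I -> g) z :
  ip (\sum_(i <- r) F i) z = \sum_(i <- r) ip (F i) z.
Proof. by rewrite linear_sumlz. Qed.

Lemma ip_sumr I (r : seq I) (F : I -> g) z :
  ip z (\sum_(i <- r) F i) = \sum_(i <- r) ip z (F i).
Proof. by rewrite linear_sumr. Qed.

Lemma ip_ge0 x : 0 <= ip x x.
Proof.
have [->|/neq0_dnorm_gt0/ltW //] := eqVneq x 0.
by rewrite ip0l.
Qed.

Lemma ip_eq0 x : (ip x x == 0) = (x == 0).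
Proof.
have [->|x0] := eqVneq x 0; first by rewrite ip0l eqxx.
by rewrite gt_eqF ?neq0_dnorm_gt0.
Qed.

Lemma ip_ext x y : (forall z, ip x z = ip y z) -> x = y.
Proof.
move=> xy; apply/eqP; rewrite -subr_eq0 -ip_eq0.
by rewrite ipDl ipNl xy subrr.
Qed.

Lemma orthonormal_cons x f :
  orthonormal ip (x :: f) =
  [&& ip x x == 1, all [pred y | ip x y == 0] f & orthonormal ip f].
Proof. by rewrite /orthonormal /= andbT -!andbA; congr andb; rewrite andbCA. Qed.

Lemma orthonormal_uniq f : orthonormal ip f -> uniq f.
Proof.
elim: f => //= x f IHf; rewrite orthonormal_cons => /and3P[/eqP x1 /allP xf].
move/IHf->; rewrite andbT; apply/negP => /xf /=.
by rewrite x1 oner_eq0.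
Qed.

Lemma orthonormal_ip f :
  orthonormal ip f -> {in f &, forall x y, ip x y = (x == y)%:R}.
Proof.
elim: f => //= z f IHf; rewrite orthonormal_cons.
move=> /and3P[/eqP z1 /allP zf /IHf of_] x y.
rewrite !inE => /predU1P[->|xf] /predU1P[->|yf]; last exact: of_.
- by rewrite z1 eqxx.
- have /eqP zy := zf _ yf; rewrite zy; case: eqVneq => // zy'.
  by move: z1; rewrite {2}zy' zy => /esym/eqP; rewrite oner_eq0.
- have /eqP zx := zf _ xf; rewrite ipC zx; case: eqVneq => // zx'.
  by move: z1; rewrite -{2}zx' zx => /esym/eqP; rewrite oner_eq0.
Qed.

Lemma orthonormal_sum f y :
  orthonormal ip f -> y \in f -> \sum_(x <- f) ip y x *: x = y.
Proof.
move=> of_ yf; rewrite (bigD1_seq y) ?orthonormal_uniq //=.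
rewrite (orthonormal_ip of_) // eqxx scale1r big_seq_cond big1 ?addr0 //.
move=> x /andP[xf xy]; rewrite (orthonormal_ip of_) // eq_sym (negPf xy).
exact: scale0r.
Qed.

Lemma orthonormal_expand U f x :
  orthonormal_basis ip U f -> x \in U -> x = \sum_(v <- f) ip x v *: v.
Proof.
case=> bf of_; rewrite -(span_basis bf) => /(@coord_span _ _ _ (in_tuple f)) ->.
under [RHS]eq_bigr do rewrite ip_suml scaler_suml.
rewrite exchange_big /=; apply: eq_bigr => i _.
under eq_bigr do rewrite ipZl -scalerA.
by rewrite -scaler_sumr (orthonormal_sum of_) // mem_nth.
Qed.

Lemma parseval U f x y :
  orthonormal_basis ip U f -> x \in U ->
  \sum_(v <- f) ip x v * ip v y = ip x y.
Proof.
move=> bf xU; rewrite [in RHS](orthonormal_expand bf xU) ip_suml.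
by apply: eq_bigr => v _; rewrite ipZl.
Qed.

Lemma orthonormal_free f : orthonormal ip f -> free f.
Proof.
elim: f => [|x f IHf]; first by rewrite nil_free.
rewrite orthonormal_cons free_cons => /and3P[/eqP x1 /allP xf /IHf ->].
rewrite andbT; apply/negP => /(@coord_span _ _ _ (in_tuple f)) xE.
have /eqP := x1; rewrite {2}xE ip_sumr big1 ?[0 == 1]eq_sym ?oner_eq0 // => i _.
by rewrite ipZr (eqP (xf _ (mem_nth _ _))) // mulr0.
Qed.

Definition orthogonal_in U x : {vspace g} := (U :&: orthov ip <[x]>)%VS.

Lemma mem_orthogonal_in U x y :
  (y \in orthogonal_in U x) = (y \in U) && (ip y x == 0).
Proof. by rewrite memv_cap mem_orthov1. Qed.

Lemma orthonormal_basis_cons U x f :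
  x \in U -> ip x x = 1 -> orthonormal_basis ip (orthogonal_in U x) f ->
  orthonormal_basis ip U (x :: f).
Proof.
move=> xU x1 [bf of_].
have fU y : y \in f -> (y \in U) && (ip y x == 0).
  by move=> /(basis_mem bf); rewrite mem_orthogonal_in.
have ox : orthonormal ip (x :: f).
  rewrite orthonormal_cons x1 eqxx of_ andbT /=; apply/allP => y /fU/andP[_].
  by rewrite ipC.
split=> //; rewrite basisEfree orthonormal_free //=; apply/andP; split.
  by apply/span_subvP => y; rewrite inE => /predU1P[->|/fU/andP[]].
rewrite (_ : (size f).+1 = size (x :: f)) // -(eqP (orthonormal_free ox)).
apply/dimvS/subvP => y yU; rewrite -(subrK (ip y x *: x) y) addrC memvD //.
  by rewrite memvZ // memv_span ?mem_head.
rewrite span_cons (span_basis bf) -[y - _]add0r memv_add ?mem0v //.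
by rewrite mem_orthogonal_in rpredB ?memvZ // !ipE x1 mulr1 subrr eqxx.
Qed.

Lemma orthogonal_in_dim U x :
  x \in U -> ip x x = 1 -> (\dim (orthogonal_in U x) < \dim U)%N.
Proof.
move=> xU x1; rewrite ltn_neqAle (dimv_leqif_eq (capvSl _ _)) dimvS ?capvSl //.
rewrite andbT; apply/negP => /eqP UE; move: xU.
by rewrite -UE mem_orthogonal_in x1 oner_eq0 andbF.
Qed.

Definition normalize x := (Num.sqrt (ip x x))^-1 *: x.

Lemma normalize1 x : x != 0 -> ip (normalize x) (normalize x) = 1.
Proof.
move=> x0; rewrite !ipE mulrA -invfM -expr2 sqr_sqrtr ?ip_ge0 //.
by rewrite mulVf // ip_eq0.
Qed.

Lemma exists_orthonormal_basis U : exists f, orthonormal_basis ip U f.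
Proof.
have [k] := ubnP (\dim U); elim: k U => // k IHk U dU.
have [U0|[x xU x0]] : U = 0%VS \/ exists2 x, x \in U & x != 0.
  have [|U0] := eqVneq U 0%VS; first by left.
  by right; exists (vpick U); rewrite ?memv_pick ?vpick0.
  by exists [::]; split => //; rewrite U0 nil_basis.
have yU : normalize x \in U by rewrite memvZ.
have y1 := normalize1 x0.
have [f ff] := IHk _ (leq_trans (orthogonal_in_dim yU y1) dU).
by exists (normalize x :: f); apply: orthonormal_basis_cons.
Qed.

(** When [f] spans a proper subspace, this is the adjoint of the restriction of [F] to it, so the
    adjunction holds only against test vectors of that subspace. *)
Definition adjoint (f : seq g) (F : g -> g) x := \sum_(v <- f) ip x (F v) *: v.

Lemma adjointP U f (F : {linear g -> g}) x y :
  orthonormal_basis ip U f -> y \in U -> ip (adjoint f F x) y = ip x (F y).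
Proof.
move=> bf yU; rewrite ip_suml [y in RHS](orthonormal_expand bf yU).
rewrite linear_sum ip_sumr; apply: eq_bigr => v _.
by rewrite linearZ !ipE mulrC (ipC v).
Qed.

Lemma adjoint_mem U f (F : g -> g) x :
  orthonormal_basis ip U f -> adjoint f F x \in U.
Proof.
case=> bf _; rewrite /adjoint big_seq; apply: memv_suml => v vf.
by rewrite memvZ // (basis_mem bf).
Qed.

(** Expanding [v] in the vector space basis and summing over [f] recovers the diagonal coordinates
    of [F]. The right side does not mention [f], so the lemma also compares the traces in two
    orthonormal bases. *)
Lemma trace_orthonormal f (F : {linear g -> g}) :
  orthonormal_basis ip fullv f ->
  \sum_(v <- f) ip (F v) v =
  \tr (passmx.mxof (vbasis {:g}) (vbasis {:g}) (linfun F)).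
Proof.
move=> bf; set b := vbasis {:g}.
have bE y i : \sum_(v <- f) coord b i v * ip y v = coord b i y.
  rewrite [y in RHS](orthonormal_expand bf (memvf y)) linear_sum.
  by apply: eq_bigr => v _; rewrite linearZ mulrC.
have FE v : ip (F v) v = \sum_i coord b i v * ip (F b`_i) v.
  rewrite {1}(coord_vbasis (memvf v)) linear_sum ip_suml.
  by apply: eq_bigr => i _; rewrite linearZ ipZl.
under eq_bigr do rewrite FE.
rewrite exchange_big; apply: eq_bigr => i _; rewrite bE mxE /=.
by rewrite passmx.vecof_delta lfunE mxE.
Qed.

End Euclidean.

(** * Normal operators *)

Lemma normal_of_skt_equation (R : realType) m (M : 'M[R]_m) (mu : R) :
  mu *: (M + M^T) + M *m M + 2 *: (M *m M^T) + M^T *m M^T = 0 ->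
  M *m M^T = M^T *m M.
Proof.
move=> Q; have [B BE] : exists B, B = M + M^T by exists (M + M^T).
have BT : B^T = B by rewrite BE raddfD /= trmxK addrC.
pose G := mu *: B + B *m B.
(* Modulo the hypothesis, both sides are [M^T *m M - M *m M^T]; hence [G = 0] is exactly
   normality. *)
have GE : G = B *m M - M *m B.
  apply/eqP; rewrite -subr_eq0 -Q /G BE !(mulmxDl, mulmxDr) opprB.
  rewrite scaler_nat mulr2n; apply/eqP/matrixP => i j.
  by rewrite !mxE; ring.
have BG : B *m G = G *m B.
  by rewrite /G mulmxDl mulmxDr -scalemxAl -scalemxAr mulmxA.
have GT : G^T = G.
  by rewrite /G raddfD /= linearZ /= trmx_mul BT.
clearbody G.
have trGG : \tr (G *m G) = 0.
  rewrite {2}GE mulmxBr raddfB /= !mulmxA -BG.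
  by rewrite [in X in _ - X]mxtrace_mulC !mulmxA subrr.
(* [G] is symmetric, so the trace of its square is the sum of the squares of its entries. *)
have G0 : G = 0.
  apply/matrixP => i j; rewrite mxE; move: trGG; rewrite -{2}GT /mxtrace.
  have F0 k : 0 <= (G *m G^T) k k.
    by rewrite mxE sumr_ge0 // => l _; rewrite mxE -expr2 sqr_ge0.
  move/eqP; rewrite psumr_eq0 // => /allP/(_ i (mem_index_enum _)) /=.
  rewrite mxE psumr_eq0 => [|l _]; last by rewrite mxE -expr2 sqr_ge0.
  move=> /allP/(_ j (mem_index_enum _)) /=.
  by rewrite mxE mulf_eq0 orbb => /eqP.
move/eqP: GE; rewrite G0 BE mulmxDl mulmxDr opprD addrACA subrr add0r.
by rewrite eq_sym subr_eq0 => /eqP.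
Qed.

(* J makes W a complex vector space and D complex linear. If x + i y is a
   complex eigenvector of the real matrix of D, then x + J y or x - J y is an
   eigenvector in this sense. *)
Lemma complex_eigenvector (R : realType) (g : vectType R) (W : {vspace g})
    (D J : 'End(g)) :
  W != 0%VS -> {in W, forall x, D x \in W} -> {in W, forall x, J x \in W} ->
  (forall x, J (J x) = - x) -> {in W, forall x, D (J x) = J (D x)} ->
  exists z, [/\ z \in W, z != 0 &
                exists ab : R * R, D z = ab.1 *: z + ab.2 *: J z].
Proof.
move=> W0 DW JW JJ DJ; pose b := vbasis W; have bW := vbasisP W.
have b_free := basis_free bW.
pose M := \matrix_(i < \dim W, j < \dim W) coord b j (D b`_i).
have dW : (0 < \dim W)%N by rewrite lt0n dimv_eq0.
have [[ca cb]] := eigenvalue_closed (map_mx (real_complex R) M) dW.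
case/eigenvalueP => v vM v0.
pose vec (r : 'I_(\dim W) -> R) := \sum_i r i *: b`_i.
have vecW r : vec r \in W.
  by apply: memv_suml => i _; rewrite memvZ // vbasis_mem // mem_nth ?size_tuple.
have Dvec r : D (vec r) = vec (fun j => \sum_i r i * M i j).
  rewrite /vec linear_sum; under [RHS]eq_bigr do rewrite scaler_suml.
  rewrite exchange_big; apply: eq_bigr => i _; rewrite linearZ /=.
  rewrite [in LHS](coord_basis bW (DW _ _)); last first.
    by rewrite vbasis_mem // mem_nth ?size_tuple.
  by rewrite scaler_sumr; apply: eq_bigr => j _; rewrite scalerA !mxE.
clearbody M.
pose x := vec (fun i => complex.Re (v 0 i)).
pose y := vec (fun i => complex.Im (v 0 i)).
have MRe i : \sum_k complex.Re (v 0 k) * M k i =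
    ca * complex.Re (v 0 i) - cb * complex.Im (v 0 i).
  have /matrixP/(_ 0 i)/(congr1 (@complex.Re R)) := vM; rewrite !mxE.
  rewrite (raddf_sum (@complex.Re R)) => E.
  transitivity (complex.Re ((ca +i* cb)%C * v 0 i)); last by case: (v 0 i).
  rewrite -E; apply: eq_bigr => k _; rewrite mxE; case: (v 0 k) => p q /=.
  by rewrite mulr0 subr0.
have MIm i : \sum_k complex.Im (v 0 k) * M k i =
    cb * complex.Re (v 0 i) + ca * complex.Im (v 0 i).
  have /matrixP/(_ 0 i)/(congr1 (@complex.Im R)) := vM; rewrite !mxE.
  rewrite (raddf_sum (@complex.Im R)) => E.
  transitivity (complex.Im ((ca +i* cb)%C * v 0 i)).
    rewrite -E; apply: eq_bigr => k _; rewrite mxE; case: (v 0 k) => p q /=.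
    by rewrite mulr0 add0r.
  by case: (v 0 i) => p q /=; rewrite addrC.
have Dx : D x = ca *: x - cb *: y.
  rewrite Dvec /x /y /vec !scaler_sumr -sumrB; apply: eq_bigr => i _.
  by rewrite MRe scalerBl !scalerA.
have Dy : D y = cb *: x + ca *: y.
  rewrite Dvec /x /y /vec !scaler_sumr -big_split; apply: eq_bigr => i _.
  by rewrite MIm scalerDl !scalerA.
have xW : x \in W := vecW _.
have yW : y \in W := vecW _.
(* If nonzero, [x + J y] has eigenvalue ca + i cb and [x - J y] has the conjugate one. If both
   vanish, then [x] and [y] vanish, and so does [v]. *)
have [z0|z0] := eqVneq (x + J y) 0; last first.
  exists (x + J y); split => //; first by rewrite memvD ?JW.
  exists (ca, cb) => /=; rewrite linearD /= DJ // Dx Dy !linearD !linearZ /= JJ.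
  by rewrite [cb *: J x + _]addrC addrACA [cb *: - y + _]addrC.
exists (x - J y); split; first by rewrite memvB ?JW.
  apply: contraNneq v0 => z0'.
  have x0 : x = 0.
    have /eqP : x *+ 2 = 0.
      by rewrite mulr2n -[RHS]addr0 -{1}z0 -z0' addrACA subrr addr0.
    by rewrite -scaler_nat scaler_eq0 pnatr_eq0 => /eqP.
  have y0 : y = 0.
    by apply: oppr_inj; rewrite oppr0 -JJ -[J y]add0r -{1}x0 z0 linear0.
  have coord0 r : vec r = 0 -> forall i, r i = 0.
    by move=> r0 i; rewrite -(coord_sum_free r i b_free) -/(vec r) r0 linear0.
  apply/eqP/rowP => i; rewrite mxE.
  by case: (v 0 i) (coord0 _ x0 i) (coord0 _ y0 i) => p q /= -> ->.
exists (ca, - cb) => /=; rewrite linearB /= DJ // Dx Dy.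
rewrite !(linearD, linearN, linearZ) /= !JJ.
rewrite opprK !scaleNr !scalerN.
by rewrite [- (cb *: J x) + _]addrC addrACA [- (cb *: y) + _]addrC.
Qed.

Definition block_rotation (R : realType) (g : vectType R) (D J : 'End(g))
    (x y : g) (a b : R) :=
  [/\ J x = y /\ J y = - x, D x = a *: x + b *: y & D y = - b *: x + a *: y].

(** Induction on the dimension of [W]. By normality a unit eigenvector [x] of [D] is also an
    eigenvector of [Dt], for the conjugate eigenvalue, so the orthogonal complement of [x] and [J x]
    is stable under [D], [Dt] and [J]. *)
Lemma normal_block_basis (R : realType) (g : vectType R)
    (ip : {dot g for idfun}) (D J : 'End(g)) (Dt : g -> g) (W : {vspace g}) :
  (forall x, J (J x) = - x) -> (forall x y, ip (J x) (J y) = ip x y) ->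
  {in W, forall x, D x \in W} -> {in W, forall x, Dt x \in W} ->
  {in W, forall x, J x \in W} -> {in W, forall x, D (J x) = J (D x)} ->
  {in W &, forall x y, ip (Dt x) y = ip x (D y)} ->
  {in W &, forall x y, ip (D x) (D y) = ip (Dt x) (Dt y)} ->
  exists (e : seq g) (ra rb : nat -> R), orthonormal_basis ip W e /\
    forall i, (2 * i < size e)%N ->
      block_rotation D J e`_(2 * i) e`_(2 * i).+1 (ra i) (rb i).
Proof.
move=> JJ JI; have Jskew x y : ip (J x) y = - ip x (J y).
  by rewrite -JI JJ ipNl.
have xJx x : ip x (J x) = 0.
  by have := Jskew x x; rewrite ipC; lra.
have [k] := ubnP (\dim W); elim: k W => // k IHk W dW DW DtW JW DJ adj nrm.
have [W0|W0] := eqVneq W 0%VS.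
  exists [::], (fun=> 0), (fun=> 0); split => //.
  by split => //; rewrite W0 nil_basis.
have [z [zW z0 [[a b] /= Dz]]] := complex_eigenvector W0 DW JW JJ DJ.
pose x := normalize ip z; have x1 : ip x x = 1 by apply: normalize1.
have xW : x \in W by apply: memvZ.
have Dx : D x = a *: x + b *: J x.
  rewrite /x /normalize !linearZ /= Dz scalerDr !scalerA.
  by rewrite ![_^-1 * _]mulrC.
clearbody x.
have JDx : D (J x) = a *: J x - b *: x.
  by rewrite DJ // Dx linearD !linearZ /= JJ scalerN.
(* The squared norm of the difference of the two sides expands to 0, normality replacing the norm of
   [Dt x] by that of [D x]. *)
have Dtx : Dt x = a *: x - b *: J x.
  apply/eqP; rewrite -subr_eq0 -(ip_eq0 ip) !ipE.
  rewrite !(ipC _ _ (Dt x)) -nrm // !adj // ?JW // JDx Dx.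
  rewrite !ipE JI (ipC _ (J x)) xJx x1; apply/eqP; ring.
have JxW : J x \in orthogonal_in ip W x.
  by rewrite mem_orthogonal_in JW //= ipC xJx.
have Jx1 : ip (J x) (J x) = 1 by rewrite JI.
pose V := orthogonal_in ip (orthogonal_in ip W x) (J x).
have memV y : y \in V -> [/\ y \in W, ip y x = 0 & ip y (J x) = 0].
  rewrite mem_orthogonal_in => /andP[]; rewrite mem_orthogonal_in.
  by move=> /andP[? /eqP ?] /eqP.
have inV y : y \in W -> ip y x = 0 -> ip y (J x) = 0 -> y \in V.
  by move=> yW y1 y2; rewrite !mem_orthogonal_in yW y1 y2 eqxx.
have VW : {subset V <= W} by move=> y /memV[].
have [|||||||e [ra [rb [eV eb]]]] := IHk V.
- rewrite -ltnS; apply: leq_trans dW; rewrite ltnS.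
  apply: leq_ltn_trans (orthogonal_in_dim xW x1).
  exact/dimvS/capvSl.
- move=> y /memV[yW yx yJx]; apply: inV; first exact: DW.
    by rewrite ipC -adj // Dtx !ipE !(ipC _ _ y) yx yJx !mulr0 subrr.
  rewrite ipC Jskew -DJ // -adj ?JW // Dtx !ipE !(ipC _ _ (J y)) !Jskew JJ.
  rewrite ipNr yx yJx; ring.
- move=> y /memV[yW yx yJx]; apply: inV; first exact: DtW.
    by rewrite adj // Dx !ipE yx yJx !mulr0 addr0.
  rewrite adj ?JW // JDx !ipE yx yJx; ring.
- move=> y /memV[yW yx yJx]; apply: inV; first exact: JW.
    by rewrite Jskew yJx oppr0.
  by rewrite JI.
- by move=> y /VW; apply: DJ.
- by move=> y y' /VW yW /VW; apply: adj.
- by move=> y y' /VW yW /VW; apply: nrm.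
exists [:: x, J x & e], (fun i => if i is i'.+1 then ra i' else a),
  (fun i => if i is i'.+1 then rb i' else b); split.
  by do 2!apply: orthonormal_basis_cons => //.
case=> [_|i]; last by rewrite mulnS => ie; apply: eb; rewrite -2!ltnS.
by split=> /=; [split | | rewrite JDx scaleNr addrC].
Qed.

(** * Real and imaginary parts of dbar and ddbar *)

Section ComplexParts.
Variables (R : realType) (g : vectType R) (J : 'End(g)).
Local Notation Re := (@complex.Re R).
Local Notation Im := (@complex.Im R).

Lemma half_complex (z : R[i]) : z / 2 = ((Re z / 2) +i* (Im z / 2))%C.
Proof.
apply: (mulIf (x := 2)); first by rewrite pnatr_eq0.
rewrite divfK ?pnatr_eq0 // mulr_natr mulr2n; case: z => p q /=.
by rewrite [p in LHS]splitr [q in LHS]splitr.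
Qed.

Lemma Re_p10 (f : g -> R[i]) X : Re (p10 J f X) = (Re (f X) + Im (f (J X))) / 2.
Proof.
by rewrite /p10 half_complex /=; case: (f X) (f (J X)) => ? ? [? ?] /=; field.
Qed.
Lemma Im_p10 (f : g -> R[i]) X : Im (p10 J f X) = (Im (f X) - Re (f (J X))) / 2.
Proof.
by rewrite /p10 half_complex /=; case: (f X) (f (J X)) => ? ? [? ?] /=; field.
Qed.
Lemma Re_p01 (f : g -> R[i]) X : Re (p01 J f X) = (Re (f X) - Im (f (J X))) / 2.
Proof.
by rewrite /p01 half_complex /=; case: (f X) (f (J X)) => ? ? [? ?] /=; field.
Qed.
Lemma Im_p01 (f : g -> R[i]) X : Im (p01 J f X) = (Im (f X) + Re (f (J X))) / 2.
Proof.
by rewrite /p01 half_complex /=; case: (f X) (f (J X)) => ? ? [? ?] /=; field.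
Qed.

Lemma Im_add (x y : R[i]) : Im (x + y) = Im x + Im y.
Proof. by case: x y => ? ? []. Qed.
Lemma Im_opp (x : R[i]) : Im (- x) = - Im x.
Proof. by case: x. Qed.

Definition partE := (Im_add, Re_p10, Im_p10, Re_p01, Im_p01).

(* On a Hermitian Lie algebra the real part of dbar omega is d omega / 2, which is
   closed, so only imaginary parts carry information. *)
Lemma Im_part12 (a : g -> g -> g -> R[i]) (c : g -> g -> g -> R) X Y Z :
  (forall X Y Z, a X Y Z = (c X Y Z)%:C%C) ->
  Im (part12 J a X Y Z) =
    (c (J X) Y Z + c X (J Y) Z + c X Y (J Z) + 3 * c (J X) (J Y) (J Z)) / 8.
Proof.
by move=> ac; rewrite /part12 /on3 !partE !ac /=; field.
Qed.

(** Each slot contributes a factor (1 -+ i J) / 2. Summed over the six choices of types, the terms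
    with an odd number of [J] cancel, those with two have weight 2/16, and those with none or four
    have weight 6/16. The projection is thus a real operator and commutes with [Im]. *)
Lemma Im_part22 (b : g -> g -> g -> g -> R[i]) X Y Z W :
  Im (part22 J b X Y Z W) =
  (3 * (Im (b X Y Z W) + Im (b (J X) (J Y) (J Z) (J W))) +
   Im (b (J X) (J Y) Z W) + Im (b (J X) Y (J Z) W) + Im (b (J X) Y Z (J W)) +
   Im (b X (J Y) (J Z) W) + Im (b X (J Y) Z (J W)) + Im (b X Y (J Z) (J W))) / 8.
Proof. by rewrite /part22 /on4 !partE; field. Qed.

Lemma Im_dform3 (br : {bilinear g -> g -> g}) (a : g -> g -> g -> R[i]) X Y Z W :
  Im (dform3 br a X Y Z W) =
  - Im (a (br X Y) Z W) + Im (a (br X Z) Y W) - Im (a (br X W) Y Z)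
  - Im (a (br Y Z) X W) + Im (a (br Y W) X Z) - Im (a (br Z W) X Y).
Proof. by rewrite /dform3 !(Im_add, Im_opp). Qed.

End ComplexParts.

(** * The rough Laplacian of J *)

Lemma levi_civita_unique (R : realType) (g : vectType R)
    (br : {bilinear g -> g -> g}) (ip : {dot g for idfun}) (X Y V : g) :
  (forall Z, 2 * ip V Z = ip (br X Y) Z - ip (br Y Z) X + ip (br Z X) Y) ->
  levi_civita br ip X Y = V.
Proof.
move=> koszul; rewrite /levi_civita; case: xgetP => [W _ WE|/(_ V)]; last first.
  by case.
apply: (ip_ext (ip := ip)) => Z.
by apply: (mulfI (x := 2)); rewrite ?pnatr_eq0 // WE koszul.
Qed.

Section RoughLaplacian.
Variables (R : realType) (g : vectType R) (br : {bilinear g -> g -> g}).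
Variables (ip : {dot g for idfun}) (J : 'End(g)) (e0 : g) (f : seq g).
Variables A P : g -> g.
Hypotheses (JJ : forall X, J (J X) = - X).
Hypothesis (JI : forall X Y, ip (J X) (J Y) = ip X Y).
Hypotheses (bf : orthonormal_basis ip fullv f) (he0 : ip e0 e0 = 1).
Hypotheses (A_sym : forall X Y, ip (A X) Y = ip X (A Y)) (A_e0 : A e0 = 0).
Hypotheses (P_skew : forall X Y, ip (P X) Y = - ip X (P Y)) (P_e0 : P e0 = 0).
Let N := levi_civita br ip.
Hypothesis N_ip : forall X Y Z, ip (levi_civita br ip X Y) Z =
  ip X e0 * ip (P Y) Z + ip (A X) Y * ip e0 Z - ip Y e0 * ip (A X) Z.

Let Jl X Y : ip (J X) Y = - ip X (J Y).
Proof. by rewrite -JI JJ ipNl. Qed.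

Let Jr X Y : ip X (J Y) = - ip (J X) Y.
Proof. by rewrite Jl opprK. Qed.

Let ip_J X : ip X (J X) = 0.
Proof. by have := Jl X X; rewrite ipC; lra. Qed.

Let N_skew v X Y : ip (N v X) Y = - ip X (N v Y).
Proof.
by rewrite (ipC _ X) !N_ip P_skew (ipC _ X (P Y)) (ipC _ e0 Y) (ipC _ e0 X); ring.
Qed.

(** Expanding [nabla2J v v] and moving [J] and [N v] across the inner product by skewness leaves
    only these three forms: mixed terms, squares, and the terms in [N v v]. *)
Let T X Y := \sum_(v <- f) ip (J (N v X)) (N v Y).
Let S X Y := \sum_(v <- f) ip (N v X) (N v Y).
Let r X Y := \sum_(v <- f) ip (N (N v v) X) Y.

Let rough_laplacian_ip X Y :
  ip (rough_laplacianJ br ip J f X) Y =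
  2 * T X Y - S (J X) Y + S X (J Y) - r (J X) Y - r X (J Y).
Proof.
rewrite ip_suml /T /S /r mulr_sumr -!sumrB -big_split -!sumrB.
apply: eq_bigr => v _; rewrite /= /nabla2J /nabla_end -/N.
rewrite !ipE !Jl !N_skew !ipE !Jl !N_skew !Jl; ring.
Qed.

Let parseval_l X Y : \sum_(v <- f) ip v X * ip v Y = ip X Y.
Proof.
rewrite -(parseval Y bf (memvf X)); apply: eq_bigr => v _.
by rewrite (ipC _ v X).
Qed.

Let ip_e0A X : ip e0 (A X) = 0.
Proof. by rewrite -A_sym A_e0 ip0l. Qed.

Let tau := \sum_(v <- f) ip (A v) v.
Let e1 := J e0.

Let TE X Y : T X Y =
  ip (J (P X)) (P Y) - ip Y e0 * ip (A X) (A e1) + ip X e0 * ip (A Y) (A e1).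
Proof.
(* [Z] gathers all that multiplies [ip v e0]. After Parseval only its [e0] component survives, since
   the image of [A] is orthogonal to [e0]. *)
pose Z := ip (J (P X)) (P Y) *: e0 + ip (J (P X)) e0 *: A Y
  - ip Y e0 *: A (J (P X)) + ip e1 (P Y) *: A X + ip X e0 *: A (J (P Y)).
transitivity (\sum_(v <- f) (ip v e0 * ip v Z
    + (- ip Y e0) * (ip v (A X) * ip v (A e1))
    + ip X e0 * (ip v (A Y) * ip v (A e1)))).
  apply: eq_bigr => v _; rewrite Jl N_ip !Jr !(ipC _ _ (N v Y)) !N_ip -/e1.
  rewrite ip_J (ipC _ (P Y) (J (P X))) (ipC _ e0 (J (P X))) (ipC _ (P Y) e1).
  rewrite (Jr e0 (A v)) -/e1 (ipC _ e1 (A v)) (Jr (P Y)) (ipC _ _ (A v)).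
  have e01 : ip e0 e1 = 0 by apply: ip_J.
  by rewrite /Z !ipE !A_sym e01; ring.
rewrite !big_split -!mulr_sumr !parseval_l /Z !ipE !ip_e0A he0 /=; ring.
Qed.

Let rE X Y : r X Y = tau * ip (P X) Y.
Proof.
(* [Z] is chosen so that [ip (N W X) Y = ip W Z] for all [W]. The vectors [N v v] add up to
   [tau *: e0], as [A] and [P] kill [e0]. *)
pose Z := ip (P X) Y *: e0 + ip Y e0 *: A X - ip X e0 *: A Y.
have NvZ v W : ip (N v v) W =
    - (ip v e0 * ip v (P W)) + ip (A v) v * ip e0 W - ip v e0 * ip v (A W).
  by rewrite N_ip P_skew !A_sym; ring.
transitivity (\sum_(v <- f) ip (N v v) Z).
  apply: eq_bigr => v _; rewrite N_ip !ipE (ipC _ e0 Y) !A_sym; ring.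
under eq_bigr do rewrite NvZ.
rewrite sumrB big_split sumrN -mulr_suml /= !parseval_l ip_e0A.
rewrite -[ip e0 (P Z)]opprK -P_skew P_e0 ip0l /Z !ipE !ip_e0A he0 -/tau; ring.
Qed.

(** In the commutator of [J] with the rough Laplacian the [S] terms cancel, leaving T(JX,Y) +
    T(X,JY) = r(JX,JY) - r(X,Y); the identity is this one with [TE] and [rE] substituted. *)
Lemma harmonic_equation :
  (forall X, J (rough_laplacianJ br ip J f X) =
     rough_laplacianJ br ip J f (J X)) <->
  (forall X Y,
     ip (J (P (J X))) (P Y) - ip Y e0 * ip (A (J X)) (A e1)
       + ip (J X) e0 * ip (A Y) (A e1)
     + (ip (J (P X)) (P (J Y)) - ip (J Y) e0 * ip (A X) (A e1)
       + ip X e0 * ip (A (J Y)) (A e1)) =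
     tau * (ip (P (J X)) (J Y) - ip (P X) Y)).
Proof.
have lapl X Y : ip (J (rough_laplacianJ br ip J f X)) Y
    - ip (rough_laplacianJ br ip J f (J X)) Y =
    2 * (r (J X) (J Y) - r X Y - T (J X) Y - T X (J Y)).
  have Nl v W : N v (- W) = - N v W.
    by apply: (ip_ext (ip := ip)) => V; rewrite N_skew !ipE N_skew.
  have Sr W V : S W (- V) = - S W V.
    by rewrite /S -sumrN; apply: eq_bigr => v _; rewrite Nl ipNr.
  have Sl W V : S (- W) V = - S W V.
    by rewrite /S -sumrN; apply: eq_bigr => v _; rewrite Nl ipNl.
  have rl W V : r (- W) V = - r W V.
    by rewrite /r -sumrN; apply: eq_bigr => v _; rewrite Nl ipNl.
  have rr W V : r W (- V) = - r W V.
    by rewrite /r -sumrN; apply: eq_bigr => v _; rewrite ipNr.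
  by rewrite Jl !rough_laplacian_ip !JJ Sr Sl rl rr; ring.
split=> [har X Y|eqn X].
  have := lapl X Y; rewrite har subrr !TE !rE; lra.
apply: (ip_ext (ip := ip)) => Y; apply/eqP; rewrite -subr_eq0 lapl.
have := eqn X Y; rewrite !TE !rE => E; apply/eqP; lra.
Qed.

End RoughLaplacian.

(** * Almost abelian Hermitian Lie algebras *)

Section AlmostAbelianStructure.
Variables (R : realType) (g : vectType R) (br : {bilinear g -> g -> g}).
Variables (ip : {dot g for idfun}) (J : 'End(g)) (u : {vspace g}) (e0 : g).
Hypotheses (hlie : is_lie_bracket br) (hu : codim1_abelian_ideal br u).
Hypothesis hJ : Defs.hermitian br ip J.
Hypotheses (he0 : ip e0 e0 = 1) (he0u : {in u, forall x, ip e0 x = 0}).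
Implicit Types x y z X Y Z : g.

Let e1 := J e0.
Let a := Jcore J u.

Let JJ X : J (J X) = - X. Proof. by case: hJ => -[]. Qed.
Let JI X Y : ip (J X) (J Y) = ip X Y. Proof. by case: hJ => -[]. Qed.

Lemma ipJl X Y : ip (J X) Y = - ip X (J Y).
Proof. by rewrite -JI JJ ipNl. Qed.

Lemma ip_J X : ip X (J X) = 0.
Proof. by have := ipJl X X; rewrite ipC; lra. Qed.

(** The orthogonal complement of [e0] contains [u], and its dimension is at most that of [u]. *)
Lemma mem_ideal x : (x \in u) = (ip e0 x == 0).
Proof.
apply/idP/eqP => [/he0u //|e0x].
have [du _ _] := hu; have e0U : e0 \in fullv := memvf e0.
have uE : u = orthogonal_in ip fullv e0.
  apply/eqP; rewrite eqEdim; apply/andP; split.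
    by apply/subvP => y /he0u yu; rewrite mem_orthogonal_in memvf ipC yu eqxx.
  by rewrite -ltnS du orthogonal_in_dim.
by rewrite uE mem_orthogonal_in memvf ipC e0x eqxx.
Qed.

Lemma mem_Jcore x : (x \in a) = (ip e0 x == 0) && (ip e1 x == 0).
Proof.
rewrite memv_cap mem_ideal; congr (_ && _); apply/idP/idP => [/memv_imgP[y]|e1x].
  by rewrite mem_ideal => yu ->; rewrite JI.
rewrite -[x]opprK -JJ memv_img // mem_ideal linearN ipNr oppr_eq0.
by rewrite -[ip _ _]opprK -ipJl oppr_eq0.
Qed.

Lemma Jcore_ip x : x \in a -> ip e0 x = 0 /\ ip e1 x = 0.
Proof. by rewrite mem_Jcore => /andP[/eqP ? /eqP]. Qed.

Lemma Jcore_J x : x \in a -> J x \in a.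
Proof.
move=> /Jcore_ip[x0 x1]; rewrite mem_Jcore JI x0 -[ip e0 _]opprK -ipJl x1.
by rewrite oppr0 eqxx.
Qed.

Lemma Jcore_ideal x : x \in a -> x \in u.
Proof. by rewrite mem_Jcore mem_ideal => /andP[]. Qed.

Lemma e1_ideal : e1 \in u.
Proof. by rewrite mem_ideal ip_J. Qed.

Lemma ip_e1 : ip e1 e1 = 1.
Proof. by rewrite JI. Qed.

Lemma br_anti X Y : br X Y = - br Y X.
Proof.
have [alt _] := hlie; apply/eqP; rewrite -subr_eq0 opprK.
by have := alt (X + Y); rewrite linearDl !linearDr /= !alt add0r addr0 => ->.
Qed.

Lemma br_e0e0 : br e0 e0 = 0.
Proof. by case: hlie. Qed.

Lemma br_ideal : {in u &, forall x y, br x y = 0}.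
Proof. by case: hu. Qed.

Lemma brE X Y : br X Y = ip X e0 *: br e0 Y - ip Y e0 *: br e0 X.
Proof.
have dec Z : exists2 z, z \in u & Z = ip Z e0 *: e0 + z.
  exists (Z - ip Z e0 *: e0); last by rewrite addrC subrK.
  by rewrite mem_ideal !ipE he0 mulr1 ipC subrr.
have [x xu XE] := dec X; have [y yu YE] := dec Y.
move: (ip X e0) XE (ip Y e0) YE => p -> q ->.
rewrite !linearDl !linearDr /= !linearZr_LR !linearZl_LR /=.
rewrite br_e0e0 !scaler0 (br_ideal xu yu) !add0r addr0.
by rewrite (br_anti x) scalerN.
Qed.

Lemma br_e0_orth X : ip (br e0 X) e0 = 0.
Proof.
rewrite -[X](subrK (ip X e0 *: e0)) linearDr linearZr_LR /= br_e0e0 scaler0 addr0.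
have [_ ideal _] := hu; rewrite ipC; apply/eqP; rewrite -mem_ideal.
by apply: ideal; rewrite mem_ideal !ipE he0 mulr1 ipC subrr.
Qed.

Variables (mu : R) (v0 w0 : g) (D : 'End(g)).
Hypothesis hL : block_form br ip J u e0 mu v0 w0 D.

Lemma D_Jcore x : x \in a -> D x \in a.
Proof. by have [_ _ /subvP Da _ _] := hL => xa; apply/Da/memv_img. Qed.

Lemma v0_Jcore : v0 \in a. Proof. by case: hL. Qed.

(** Integrability at [e0] and [x] in [a] reads [e0, x] + J [e0, J x] = 0, because [e1], [x] and
    [J x] lie in the abelian ideal. The [e1] component gives [ip w0 x = 0], and the component in [a]
    gives the commutation with [J]. *)
Lemma w0_eq0_and_DJ : w0 = 0 /\ {in a, forall x, D (J x) = J (D x)}.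
Proof.
have [v0a w0a _ _ Lx] := hL; have [_ int] := hJ.
suff key x : x \in a -> ip w0 x = 0 /\ D (J x) = J (D x).
  split=> [|x /key[] //]; apply/eqP; rewrite -(ip_eq0 ip).
  by rewrite (key _ w0a).1.
move=> xa; have Jxa := Jcore_J xa; have := int e0 x.
have e1u := e1_ideal.
rewrite (br_ideal e1u (Jcore_ideal xa)) (br_ideal e1u (Jcore_ideal Jxa)).
rewrite add0r subr0 !Lx // -/e1 linearD linearZ /= JJ => E.
have E1 : ip w0 x = 0.
  have := congr1 (ip e1) E; rewrite !ipE ip_e1 (ipC _ e1 e0) ip_J.
  rewrite (Jcore_ip (D_Jcore xa)).2 (Jcore_ip (Jcore_J (D_Jcore Jxa))).2; lra.
have E2 : ip w0 (J x) = 0.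
  have := congr1 (ip e0) E; rewrite !ipE ip_J he0.
  rewrite (Jcore_ip (D_Jcore xa)).1 (Jcore_ip (Jcore_J (D_Jcore Jxa))).1; lra.
split=> //; move: E; rewrite E1 E2 !scale0r !add0r => /(congr1 J).
by rewrite linearD /= JJ linear0 => /eqP; rewrite subr_eq0 => /eqP.
Qed.

Lemma w0_eq0 : w0 = 0. Proof. by case: w0_eq0_and_DJ. Qed.

Lemma DJ x : x \in a -> D (J x) = J (D x).
Proof. by case: w0_eq0_and_DJ => _; apply. Qed.

Lemma br_e0_e1 : br e0 e1 = mu *: e1 + v0. Proof. by case: hL. Qed.

Lemma br_e0_Jcore x : x \in a -> br e0 x = D x.
Proof.
by have [_ _ _ _ Lx] := hL => /Lx ->; rewrite w0_eq0 ip0l scale0r add0r.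
Qed.

(** * The equation on [D] imposed by the SKT condition *)

Let d_omega X Y Z :=
  - ip (J (br X Y)) Z + ip (J (br X Z)) Y - ip (J (br Y Z)) X.

(** The numerator that [Im_part12] produces from the real form [d_omega]; keeping the factor 8 apart
    avoids denominators in what follows. *)
Let c X Y Z := d_omega (J X) Y Z + d_omega X (J Y) Z + d_omega X Y (J Z)
  + 3 * d_omega (J X) (J Y) (J Z).

Let Im_dbar_omega X Y Z :
  complex.Im (dbar_omega br ip J X Y Z) = c X Y Z / 8.
Proof.
rewrite /dbar_omega (@Im_part12 _ _ _ _ d_omega) // => {}X {}Y {}Z.
by rewrite /dform2 /omega /d_omega !(rmorphD, rmorphN).
Qed.

Let dc X Y Z W := - c (br X Y) Z W + c (br X Z) Y W - c (br X W) Y Z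
  - c (br Y Z) X W + c (br Y W) X Z - c (br Z W) X Y.

Let Im_d_dbar_omega X Y Z W :
  complex.Im (dform3 br (dbar_omega br ip J) X Y Z W) = dc X Y Z W / 8.
Proof.
by rewrite Im_dform3 !Im_dbar_omega /dc; field.
Qed.

Let d_omega_lin1 X X' s Y Z :
  d_omega (s *: X + X') Y Z = s * d_omega X Y Z + d_omega X' Y Z.
Proof.
rewrite /d_omega !linearPl /= !(linearD, linearZ) /= !ipE; ring.
Qed.

Let d_omegaN2 X Y Z : d_omega X (- Y) Z = - d_omega X Y Z.
Proof.
rewrite /d_omega linearNr linearNl /= !linearN /= !ipE; ring.
Qed.

Let c_lin1 s X X' Y Z : c (s *: X + X') Y Z = s * c X Y Z + c X' Y Z.
Proof.
rewrite /c linearD linearZ /= !d_omega_lin1; ring.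
Qed.

Let c0 Y Z : c 0 Y Z = 0.
Proof. by rewrite -[0](addNr 0) -scaleN1r c_lin1; ring. Qed.

Let cN1 X Y Z : c (- X) Y Z = - c X Y Z.
Proof. by rewrite -[- X]addr0 -scaleN1r c_lin1 c0; ring. Qed.

Let cN2 X Y Z : c X (- Y) Z = - c X Y Z.
Proof. rewrite /c !linearN /= !d_omegaN2; ring. Qed.

Let c_anti X Y Z : c X Y Z = - c Y X Z.
Proof.
rewrite /c /d_omega (br_anti (J X) Y) (br_anti X (J Y)) (br_anti X Y).
by rewrite (br_anti (J X) (J Y)) !linearN /= !ipE; ring.
Qed.

Let c_Jcore : {in a & & , forall x y z, c x y z = 0}.
Proof.
move=> x y z xa ya za; rewrite /c /d_omega.
have brA x' y' : x' \in a -> y' \in a -> br x' y' = 0.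
  by move=> /Jcore_ideal x'a /Jcore_ideal y'a; apply: br_ideal.
by rewrite !brA ?Jcore_J // linear0 !ipE; ring.
Qed.

(** The infinitesimal action of [D] on omega restricted to [a]: omega(D x, y) + omega(x, D y). *)
Let h x y := ip (J (D x)) y + ip (J x) (D y).

Let h_J : {in a &, forall x y, h (J x) (J y) = h x y}.
Proof. by move=> x y xa ya; rewrite /h !DJ // !JI. Qed.

Let c_e1 : {in a &, forall x y, c e1 x y = 4 * h x y}.
Proof.
move=> x y xa ya; rewrite /c /d_omega /e1 JJ !(linearNl, linearNr) /=.
have [eu xu yu] := And3 e1_ideal (Jcore_ideal xa) (Jcore_ideal ya).
have [Jxu Jyu] := conj (Jcore_ideal (Jcore_J xa)) (Jcore_ideal (Jcore_J ya)).
rewrite !(br_ideal eu) // !(br_ideal xu) // !(br_ideal Jxu) //.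
rewrite !br_e0_Jcore ?Jcore_J // !DJ // !linearN /= !JJ !linear0 !ipE.
rewrite /h (ipJl (D y)) (ipC _ (D y)) -[ip (D x) _]opprK -ipJl; ring.
Qed.

(** The terms of [dc e0 e1 z w] that bracket [e0] with another argument; for [z] and [w] in [u] the
    other brackets vanish. *)
Let b0 z w := - c (br e0 e1) z w + c (br e0 z) e1 w - c (br e0 w) e1 z.

Let dc_e0e1 : {in u &, forall z w, dc e0 e1 z w = b0 z w}.
Proof.
move=> z w zu wu; have e1u := e1_ideal.
rewrite /dc (br_ideal e1u zu) (br_ideal e1u wu) (br_ideal zu wu) !c0 /b0; ring.
Qed.

Let dc_e1e0 : {in u &, forall z w, dc e1 (- e0) z w = b0 z w}.
Proof.
move=> z w zu wu; have e1u := e1_ideal.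
rewrite /dc (br_ideal e1u zu) (br_ideal e1u wu) (br_ideal zu wu) (br_anti e1).
rewrite !linearNl /= opprK !cN1 !c0 /b0; ring.
Qed.

Let dc_e1e1 : {in u &, forall z w, dc e1 e1 z w = 0}.
Proof.
move=> z w zu wu; have e1u := e1_ideal.
rewrite /dc (br_ideal e1u e1u) (br_ideal e1u zu) (br_ideal e1u wu).
rewrite (br_ideal zu wu) !c0; ring.
Qed.

Let dc_e0e0 : {in u &, forall z w, dc e0 (- e0) z w = 0}.
Proof.
move=> z w zu wu; rewrite /dc (br_ideal zu wu) linearNr !linearNl /= br_e0e0.
rewrite oppr0 !cN1 !cN2 !c0; ring.
Qed.

(** Applying [J] to exactly one of [e0], [e1] gives (e1, e1) or (e0, -e0), where [dc] vanishes;
    applying it to neither or both gives [b0], and [b0] is invariant under [J]. So the whole (2,2)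
    part at (e0, e1, x, y) is a nonzero multiple of [b0 x y]. *)
Lemma skt_equation :
  (forall X Y Z W, ddbar_omega br ip J X Y Z W = 0) ->
  {in a &, forall x y, mu * (ip (D x) y + ip x (D y)) + ip (D (D x)) y
     + 2 * ip (D x) (D y) + ip x (D (D y)) = 0}.
Proof.
move=> dd0; have key x y : x \in a -> y \in a -> b0 x y = 0.
  move=> xa ya; have [xu yu] := conj (Jcore_ideal xa) (Jcore_ideal ya).
  have [Jxa Jya] := conj (Jcore_J xa) (Jcore_J ya).
  have [Jxu Jyu] := conj (Jcore_ideal Jxa) (Jcore_ideal Jya).
  have b0J : b0 (J x) (J y) = b0 x y.
    rewrite /b0 br_e0_e1 !c_lin1 !(c_anti _ e1) !br_e0_Jcore // !DJ //.
    rewrite !(c_Jcore v0_Jcore) ?D_Jcore // !c_e1 ?Jcore_J ?D_Jcore //.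
    by rewrite !h_J ?D_Jcore.
  have := congr1 (@complex.Im R) (dd0 e0 e1 x y).
  rewrite /ddbar_omega Im_part22 !Im_d_dbar_omega -/e1 JJ.
  rewrite !dc_e0e1 // !dc_e1e0 // !dc_e1e1 // !dc_e0e0 // b0J /=; lra.
(* [b0] is built from omega; replacing [x] by [- J x] turns omega into the inner product. *)
move=> x y xa ya; have := key (- J x) y; rewrite rpredN Jcore_J // => /(_ isT ya).
rewrite /b0 br_e0_e1 !c_lin1 !(c_anti _ e1) !br_e0_Jcore ?rpredN ?Jcore_J //.
rewrite !(c_Jcore v0_Jcore) ?rpredN ?Jcore_J // !linearN /= !DJ //.
rewrite !c_e1 ?rpredN ?Jcore_J ?D_Jcore // /h.
rewrite !linearN /= !DJ ?D_Jcore // !JJ !linearN /= !ipE.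
rewrite !JI (ipC _ (D (D y))) (ipC _ (D y) (D x)); lra.
Qed.

Lemma skt_normal f :
  (forall X Y Z W, ddbar_omega br ip J X Y Z W = 0) ->
  orthonormal_basis ip a f ->
  {in a &, forall x y, ip (D x) (D y) = ip (adjoint ip f D x) (adjoint ip f D y)}.
Proof.
(* The rows of [M] are the coordinates of the images, so [D] acts on coordinate rows by right
   multiplication with [M], and its adjoint with [M^T]. *)
move=> dd0 bf; pose M := \matrix_(i < size f, j < size f) ip (D f`_i) f`_j.
have fa (i : 'I_(size f)) : f`_i \in a by rewrite (basis_mem bf.1) ?mem_nth.
have sumf (F : g -> R) : \sum_(v <- f) F v = \sum_(i < size f) F f`_i.
  by rewrite (big_nth 0) big_mkord.
have sumD z w : z \in a ->
    \sum_(k < size f) ip z f`_k * ip (D f`_k) w = ip (D z) w.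
  move=> za; rewrite -(sumf (fun v => ip z v * ip (D v) w)).
  rewrite [in RHS](orthonormal_expand bf za) linear_sum ip_suml.
  by apply: eq_bigr => v _; rewrite linearZ ipZl.
have sumI z w : z \in a -> \sum_(k < size f) ip z f`_k * ip w f`_k = ip z w.
  move=> za; rewrite -(sumf (fun v => ip z v * ip w v)) -(parseval w bf za).
  by apply: eq_bigr => v _; rewrite (ipC _ w).
have MM : M *m M^T = M^T *m M.
  apply: (normal_of_skt_equation (mu := mu)); apply/matrixP => i j.
  rewrite !mxE; under eq_bigr do rewrite !mxE.
  under [X in _ + 2 * X + _]eq_bigr do rewrite !mxE.
  under [X in _ + X = _]eq_bigr do rewrite !mxE mulrC.
  rewrite !sumD ?sumI ?D_Jcore // -(skt_equation dd0 (fa i) (fa j)).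
  by rewrite (ipC _ f`_i (D f`_j)) (ipC _ f`_i (D (D f`_j))).
move=> x y xa ya; pose r z : 'rV_(size f) := \row_i ip z f`_i.
have rD z : z \in a -> r (D z) = r z *m M.
  move=> za; apply/rowP => j; rewrite !mxE -sumD //.
  by apply: eq_bigr => k _; rewrite !mxE.
have rDt z : z \in a -> r (adjoint ip f D z) = r z *m M^T.
  move=> za; apply/rowP => j; rewrite !mxE (adjointP _ _ bf) // -sumI //.
  by apply: eq_bigr => k _; rewrite !mxE.
have ipr z w : z \in a -> ip z w = (r z *m (r w)^T) 0 0.
  by move=> za; rewrite mxE -sumI //; apply: eq_bigr => k _; rewrite !mxE.
rewrite (ipr _ _ (D_Jcore xa)) (ipr _ _ (adjoint_mem _ _ bf)) !rD // !rDt //.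
by rewrite !trmx_mul trmxK !mulmxA -[_ *m M *m _]mulmxA MM !mulmxA.
Qed.

Lemma skt_normal_form :
  (forall X Y Z W, ddbar_omega br ip J X Y Z W = 0) ->
  exists (e : seq g) (ra rb : nat -> R), orthonormal_basis ip a e /\
    forall i, (2 * i < size e)%N ->
      block_rotation D J e`_(2 * i) e`_(2 * i).+1 (ra i) (rb i) /\
      (ra i = 0 \/ ra i = - (mu / 2)).
Proof.
move=> dd0; have [f bf] := exists_orthonormal_basis ip a.
have [|||||e [ra [rb [be eb]]]] :=
    @normal_block_basis _ _ ip D J (adjoint ip f D) a JJ JI D_Jcore.
- by move=> x _; apply: adjoint_mem bf.
- exact: Jcore_J.
- exact: DJ.
- by move=> x y xa ya; apply: adjointP bf _.
- exact: skt_normal dd0 bf.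
exists e, ra, rb; split=> // i ie; have [[Jx Jy] Dx Dy] := eb i ie.
split; first exact: eb.
have xa : e`_(2 * i) \in a by rewrite (basis_mem be.1) ?mem_nth.
have x1 : ip e`_(2 * i) e`_(2 * i) = 1.
  by rewrite (orthonormal_ip be.2) ?mem_nth // eqxx.
move: (e`_(2 * i)) (e`_(2 * i).+1) Jx Jy Dx Dy xa x1 => x y Jx Jy Dx Dy xa x1.
have DDx : D (D x) = ra i *: D x + rb i *: D y.
  by rewrite {1}Dx linearD !linearZ.
(* At (x, x) the terms in [rb i] cancel and 4 ra (ra + mu / 2) = 0 remains. *)
have := skt_equation dd0 xa xa.
rewrite DDx Dy Dx -Jx !ipE JI !(ipC _ (J x) x) ip_J x1.
move=> E; have /eqP : ra i * (ra i + mu / 2) = 0 by lra.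
rewrite mulf_eq0 addr_eq0 => /orP[] /eqP; [by left | by right].
Qed.

(** * The Levi-Civita connection and the harmonicity criterion *)

Lemma Jcore_decomposition X :
  exists p q, exists2 x, x \in a & X = p *: e0 + q *: e1 + x.
Proof.
exists (ip e0 X), (ip e1 X), (X - (ip e0 X *: e0 + ip e1 X *: e1)).
  rewrite mem_Jcore !ipE he0 ip_e1 ip_J (ipC _ e1 e0) ip_J.
  by rewrite !mulr0 !mulr1 addr0 add0r !subrr eqxx.
by rewrite addrC subrK.
Qed.

Lemma Jcore_ext x y : x \in a -> y \in a ->
  {in a, forall z, ip x z = ip y z} -> x = y.
Proof.
move=> xa ya xy; apply/eqP; rewrite -subr_eq0 -(ip_eq0 ip) ipDl ipNl.
by rewrite xy ?rpredB // subrr.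
Qed.

Lemma br_e0_decomposition p q x : x \in a ->
  br e0 (p *: e0 + q *: e1 + x) = q *: (mu *: e1 + v0) + D x.
Proof.
move=> xa; rewrite !linearDr !linearZr_LR /= br_e0e0 scaler0 add0r.
by rewrite br_e0_e1 br_e0_Jcore.
Qed.

(** As [w0 = 0], [e1] is an eigenvector of the transpose of ad e0. This gives the values of [A e1]
    and [P e1]. *)
Lemma ip_e1_br X : ip e1 (br e0 X) = mu * ip e1 X.
Proof.
have [p [q [x xa ->]]] := Jcore_decomposition X.
rewrite br_e0_decomposition // !ipE ip_e1 (ipC _ e1 e0) ip_J.
by rewrite (Jcore_ip v0_Jcore).2 (Jcore_ip xa).2 (Jcore_ip (D_Jcore xa)).2; ring.
Qed.

(** By [brE] each bracket in the Koszul formula is a combination of values of ad e0 weighted by [e0]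
    components; grouping the terms leaves the half sum and half difference of ad e0 and its
    transpose [Lt]. *)
Lemma levi_civita_symmetric_skew f : orthonormal_basis ip fullv f ->
  exists A P : g -> g,
  [/\ forall X Y, ip (A X) Y = 2^-1 * (ip (br e0 X) Y + ip X (br e0 Y)),
      forall X Y, ip (P X) Y = 2^-1 * (ip (br e0 X) Y - ip X (br e0 Y)) &
      forall X Y Z, ip (levi_civita br ip X Y) Z =
        ip X e0 * ip (P Y) Z + ip (A X) Y * ip e0 Z - ip Y e0 * ip (A X) Z].
Proof.
move=> bf; pose Lt := adjoint ip f (br e0).
have adjL X Y : ip (Lt X) Y = ip X (br e0 Y).
  exact: adjointP bf (memvf Y).
exists (fun X => 2^-1 *: (br e0 X + Lt X)), (fun X => 2^-1 *: (br e0 X - Lt X)).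
split=> [X Y|X Y|X Y Z]; try by rewrite !ipE adjL.
pose V := ip X e0 *: (2^-1 *: (br e0 Y - Lt Y))
  + ip (2^-1 *: (br e0 X + Lt X)) Y *: e0
  - ip Y e0 *: (2^-1 *: (br e0 X + Lt X)).
rewrite (@levi_civita_unique _ _ _ _ _ _ V) => [|{}Z]; first by rewrite /V !ipE.
rewrite (brE X Y) (brE Y Z) (brE Z X) /V !ipE !adjL (ipC _ e0 Z).
by rewrite (ipC _ Y (br e0 Z)) (ipC _ X (br e0 Y)) (ipC _ X (br e0 Z)); field.
Qed.

(** [tau] is the trace of ad e0, to which [e0] contributes 0 and [e1] contributes [mu]; so
    [tau - mu] is the trace of [D] on [a]. *)
Lemma harmonic_basis f (tau := \sum_(v <- f) ip (br e0 v) v) :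
  orthonormal_basis ip fullv f ->
  (forall X, J (rough_laplacianJ br ip J f X) =
     rough_laplacianJ br ip J f (J X)) <->
  D v0 = (tau - mu) *: v0.
Proof.
move=> bf; have [A [P [AE PE NE]]] := levi_civita_symmetric_skew bf.
have A_sym X Y : ip (A X) Y = ip X (A Y).
  by rewrite (ipC _ X) !AE (ipC _ X) (ipC _ Y) addrC.
have P_skew X Y : ip (P X) Y = - ip X (P Y).
  by rewrite (ipC _ X) !PE (ipC _ X) (ipC _ Y); ring.
have A_e0 : A e0 = 0.
  apply: (ip_ext (ip := ip)) => Z; rewrite AE br_e0e0 (ipC _ e0) br_e0_orth !ip0l.
  by rewrite addr0 mulr0.
have P_e0 : P e0 = 0.
  apply: (ip_ext (ip := ip)) => Z; rewrite PE br_e0e0 (ipC _ e0) br_e0_orth !ip0l.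
  by rewrite subr0 mulr0.
have A_e1 : A e1 = mu *: e1 + 2^-1 *: v0.
  apply: (ip_ext (ip := ip)) => Z; rewrite AE br_e0_e1 ip_e1_br !ipE.
  by field.
have P_e1 : P e1 = 2^-1 *: v0.
  apply: (ip_ext (ip := ip)) => Z; rewrite PE br_e0_e1 ip_e1_br !ipE.
  by field.
have tauE : \sum_(v <- f) ip (A v) v = tau.
  by apply: eq_bigr => v _; rewrite AE (ipC _ v); field.
rewrite (harmonic_equation JJ JI bf he0 A_sym A_e0 P_skew P_e0 NE) tauE -/e1.
have v0a := v0_Jcore; have Dv0a := D_Jcore v0a.
have P_Jcore x y : x \in a -> y \in a ->
    ip (P x) y = 2^-1 * (ip (D x) y - ip x (D y)).
  by move=> xa ya; rewrite PE !br_e0_Jcore.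
split=> [eqn|Dv0].
  apply: (Jcore_ext Dv0a); first exact: memvZ.
  (* Only the component (e0, z) of the equation is needed for this direction. *)
  move=> w wa; have [z za Jz] : exists2 z, z \in a & J z = w.
    by exists (- J w); rewrite ?rpredN ?Jcore_J // linearN /= JJ opprK.
  have [z0 z1] := Jcore_ip za; have [w0' w1] := Jcore_ip wa.
  have := eqn e0 z; rewrite -/e1 Jz P_e0 A_e0 linear0 P_e1 A_e1 !ipE he0.
  rewrite (ipC _ e1 e0) ip_J (ipC _ z) z0 (ipC _ w e0) w0' linearZ /= !ipE.
  rewrite (A_sym w e1) A_e1 !ipE (ipC _ w e1) w1 (AE w v0) !br_e0_Jcore //.
  rewrite (ipC _ (J v0)) P_Jcore ?Jcore_J //.
  have -> : ip (D z) (J v0) = - ip (D w) v0.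
    by rewrite -Jz DJ // (ipJl (D z)) opprK.
  have -> : ip z (D (J v0)) = - ip w (D v0).
    by rewrite DJ // -Jz ipJl opprK.
  rewrite (ipC _ w v0) (ipC _ w (D v0)); lra.
have ip_e0P x : ip e0 (P x) = 0 by rewrite ipC P_skew P_e0 ip0r oppr0.
have ip_e1P x : ip e1 (P x) = - (2^-1 * ip v0 x).
  by rewrite ipC P_skew P_e1 ipZr (ipC _ x).
(* On [a], [S] is the compression of [P] to [a], that is, the skew part of [D]; it commutes with [J]
   because [D] does. *)
pose S x := P x + (2^-1 * ip v0 x) *: e1.
have S_Jcore x : x \in a -> S x \in a.
  move=> xa; rewrite mem_Jcore !ipE ip_e0P ip_e1P ip_J ip_e1.
  by rewrite mulr0 mulr1 addr0 addNr eqxx.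
have P_S x : P x = S x - (2^-1 * ip v0 x) *: e1 by rewrite addrK.
have S_ip x y : x \in a -> y \in a ->
    ip (S x) y = 2^-1 * (ip (D x) y - ip x (D y)).
  by move=> xa ya; rewrite ipDl ipZl (Jcore_ip ya).2 mulr0 addr0 P_Jcore.
clearbody S.
have S_skew x y : x \in a -> y \in a -> ip (S x) y = - ip x (S y).
  by move=> xa ya; rewrite (ipC _ x) !S_ip // (ipC _ x) (ipC _ y); ring.
have SJ x : x \in a -> S (J x) = J (S x).
  move=> xa; have Sxa := S_Jcore _ xa.
  apply: Jcore_ext; rewrite ?S_Jcore ?Jcore_J // => y ya.
  rewrite ipJl !S_ip ?Jcore_J // !DJ // !ipJl (ipC _ (D x)) ; ring.
have PE' p q x : x \in a ->
    P (p *: e0 + q *: e1 + x) =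
    (q / 2) *: v0 - (2^-1 * ip v0 x) *: e1 + S x.
  move=> xa; apply: (ip_ext (ip := ip)) => Z; rewrite P_skew !ipE ip_e0P ip_e1P.
  by rewrite -[ip x (P Z)]opprK -P_skew P_S !ipE; field.
(* [kappa] is the squared norm of [A e1]. *)
pose kappa := mu ^+ 2 + ip v0 v0 / 4.
(* The hypothesis on [D v0] enters here: it expresses [ip (D x) v0] through [tau], [mu] and [S]. *)
have AE' p q x : x \in a -> ip (A (p *: e0 + q *: e1 + x)) (A e1) =
    q * kappa + tau * ip v0 x / 2 + ip (S x) v0 / 2.
  move=> xa; rewrite A_e1 ipDr !ipZr (A_sym _ e1) A_e1 AE br_e0_decomposition //.
  rewrite (br_e0_Jcore v0a) Dv0 S_ip // Dv0 !ipE.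
  rewrite (Jcore_ip v0a).1 (ipC _ e0 e1) (ipC _ e1 e0) ip_J ip_e1.
  rewrite ?(ipC _ v0 e1) (Jcore_ip v0a).2.
  rewrite (ipC _ x e1) (Jcore_ip xa).2 (ipC _ x v0) /kappa.
  by field.
move=> X Y; have [p [q [x xa ->]]] := Jcore_decomposition X.
have [p' [q' [y ya ->]]] := Jcore_decomposition Y.
have JE s t z : J (s *: e0 + t *: e1 + z) = (- t) *: e0 + s *: e1 + J z.
  by rewrite !linearD !linearZ /= JJ scalerN scaleNr [- _ + _]addrC.
have JPE s t z : J (s *: v0 - t *: e1 + z) = s *: J v0 + t *: e0 + J z.
  by rewrite !(linearD, linearN, linearZ) /= JJ opprK.
rewrite !JE !PE' ?Jcore_J // !AE' ?Jcore_J // !SJ // !JPE.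
have e0l z : z \in a -> ip e0 z = 0 by case/Jcore_ip.
have e0r z : z \in a -> ip z e0 = 0 by move=> za; rewrite ipC e0l.
have e1l z : z \in a -> ip e1 z = 0 by case/Jcore_ip.
have e1r z : z \in a -> ip z e1 = 0 by move=> za; rewrite ipC e1l.
have [Sxa Sya] := (S_Jcore _ xa, S_Jcore _ ya).
have [[Jxa Jya] Jv0a] := (Jcore_J xa, Jcore_J ya, Jcore_J v0a).
have [JSxa JSya] := (Jcore_J Sxa, Jcore_J Sya).
have e01 : ip e0 e1 = 0 := ip_J e0.
have e10 : ip e1 e0 = 0 by rewrite ipC.
have e11 := ip_e1.
rewrite !ipE JJ !ipE he0 e01 e10 e11.
rewrite !(e0l x, e0l y, e0l v0, e0l (J x), e0l (J y), e0l (S y), e0l (J (S y))) //.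
rewrite !(e0r x, e0r y, e0r v0, e0r (J x), e0r (J y), e0r (S x), e0r (J (S x))) //.
rewrite !(e1l y, e1l (J y)) // !(e1r v0, e1r (J v0), e1r (S x), e1r (J (S x))) //.
rewrite !JI (ipC _ (J v0) v0) ip_J (ipC _ (J v0)) !(ipJl (S _)) (ipC _ v0 (S y)).
by field.
Qed.
End AlmostAbelianStructure.

(** * Normal forms and traces *)

Lemma sum_pairs (V : nmodType) (F : nat -> V) m :
  \sum_(k < 2 * m) F k = \sum_(i < m) (F (2 * i)%N + F (2 * i).+1).
Proof.
elim: m => [|m IHm]; first by rewrite muln0 !big_ord0.
by rewrite mulnS !big_ord_recr /= IHm addrA.
Qed.

Section RealParts.
Variables (R : realType) (m : nat) (mu : R) (ra : 'I_m -> R).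
Hypothesis raP : forall i, ra i = 0 \/ ra i = - (mu / 2).

Lemma sum_real_parts : \sum_i ra i = - (mu / 2) * #|[pred i | ra i != 0]|%:R.
Proof.
rewrite -sum1_card natr_sum mulr_sumr [RHS]big_mkcond /=; apply: eq_bigr => i _.
rewrite inE; have [//|ri] := eqVneq (ra i) 0.
by case: (raP i) => [ri0|-> /=]; [rewrite ri0 eqxx in ri | rewrite mulr1].
Qed.

Lemma real_parts_eq0 :
  (mu = 0 \/ #|[pred i | ra i != 0]| = 0%N) -> forall i, ra i = 0.
Proof.
case=> [mu0|/eqP/pred0P r0] i.
  by case: (raP i) => ->; rewrite // mu0 mul0r oppr0.
by apply/eqP; have := r0 i; rewrite /= => /negbFE.
Qed.

End RealParts.

Section NormalForm.
Variables (R : realType) (n : nat) (g : vectType R) (ip : {dot g for idfun}).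
Variables (J D : 'End(g)) (a : {vspace g}) (mu : R) (e : seq g).
Variables ra rb : 'I_n.-1 -> R.
Hypotheses (nf : normal_form_basis ip J a mu D e ra rb).
Hypothesis size_e : size e = (2 * n.-1)%N.

Let x (i : 'I_n.-1) := e`_(2 * i).
Let y (i : 'I_n.-1) := e`_(2 * i).+1.

Let ltx (i : 'I_n.-1) : (2 * i < size e)%N.
Proof. by rewrite size_e ltn_mul2l /=. Qed.

Let lty (i : 'I_n.-1) : ((2 * i).+1 < size e)%N.
Proof. by rewrite size_e -[(2 * i).+2]addn2 -mulnSr leq_mul2l /=. Qed.

Let ipe k l : (k < size e)%N -> (l < size e)%N -> ip e`_k e`_l = (k == l)%:R.
Proof.
move=> ke le; have oe := nf.1.2.
by rewrite (orthonormal_ip oe) ?mem_nth // nth_uniq // (orthonormal_uniq oe).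
Qed.

Let ipxx i j : ip (x i) (x j) = (i == j)%:R.
Proof. by rewrite ipe // eqn_pmul2l. Qed.

Let ipyy i j : ip (y i) (y j) = (i == j)%:R.
Proof. by rewrite ipe // eqSS eqn_pmul2l. Qed.

Let ipxy i j : ip (x i) (y j) = 0.
Proof.
rewrite ipe //; case: eqP => // /(congr1 odd).
by rewrite /= !mul2n !odd_double.
Qed.

Let ipyx i j : ip (y i) (x j) = 0. Proof. by rewrite ipC ipxy. Qed.

Let sum_e (V : nmodType) (F : g -> V) :
  \sum_(v <- e) F v = \sum_(i < n.-1) (F (x i) + F (y i)).
Proof. by rewrite (big_nth 0) big_mkord size_e (sum_pairs (fun k => F e`_k)). Qed.

Lemma trace_normal_form : \sum_(v <- e) ip (D v) v = 2 * \sum_i ra i.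
Proof.
rewrite sum_e mulr_sumr; apply: eq_bigr => i _.
have [_ Dx Dy _] := nf.2 i; rewrite Dx Dy !ipE -/(x i) -/(y i).
by rewrite ipxx ipyy ipxy ipyx eqxx /=; ring.
Qed.

(** [ra i] is the value of [ip (D x) x] at the first vector of the block, so skewness kills it.
    Conversely, blocks with zero real part are skew on [e], and bilinearity extends this to [a]. *)
Lemma unitary_normal_form :
  (D @: a <= a)%VS -> {in a, forall z, D (J z) = J (D z)} ->
  (forall i, ra i = 0) <-> in_unitary ip J a D.
Proof.
move=> Da DJ; split=> [ra0|[_ _ skew] i]; last first.
  have xa : x i \in a by rewrite (basis_mem nf.1.1) ?mem_nth.
  have := skew _ _ xa xa; have [_ Dx _ _] := nf.2 i.
  by rewrite Dx !ipE -/(x i) -/(y i) ipxx ipxy ipyx eqxx /=; lra.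
have mem_e (v : g) : v \in e -> exists i, v = x i \/ v = y i.
  move=> /(nthP 0)[k]; rewrite size_e => ke <-.
  have ik : (k./2 < n.-1)%N by rewrite ltn_half_double -mul2n.
  exists (Ordinal ik); rewrite /x /y /=.
  have := odd_double_half k; rewrite -mul2n.
  by case: odd => kE; [right|left]; apply: (congr1 (nth 0 e) (esym kE)).
have skew_e : {in e &, forall v w, ip (D v) w = - ip v (D w)}.
  have DE i : D (x i) = rb i *: y i /\ D (y i) = - rb i *: x i.
    have [_ Dx Dy _] := nf.2 i.
    by rewrite Dx Dy ra0 !scale0r add0r addr0.
  move=> v w /mem_e[i vE] /mem_e[j wE].
  case: vE wE => -> [] ->; rewrite ?(DE i).1 ?(DE i).2 ?(DE j).1 ?(DE j).2 !ipE.
  - by rewrite ipyx ipxy; ring.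
  - by rewrite ipyy ipxx; case: eqVneq => [->|_] /=; ring.
  - by rewrite ipyy ipxx; case: eqVneq => [->|_] /=; ring.
  - by rewrite ipyx ipxy; ring.
split=> // z w za wa.
rewrite (orthonormal_expand nf.1 za) linear_sum !ip_suml -sumrN.
rewrite big_seq [RHS]big_seq.
apply: eq_bigr => v ve; rewrite linearZ !ipZl -mulrN; congr (_ * _).
rewrite (orthonormal_expand nf.1 wa) [D (\sum_(_ <- _) _)]linear_sum !ip_sumr.
rewrite -sumrN big_seq [RHS]big_seq; apply: eq_bigr => v' v'e.
have DZ : D (ip w v' *: v') = ip w v' *: D v' by rewrite linearZ.
by rewrite /= DZ !ipZr skew_e // mulrN.
Qed.

End NormalForm.

Theorem proposition5p14 (R : realType) (n : nat) (g : vectType R)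
    (br : {bilinear g -> g -> g}) (ip : {dot g for idfun}) (J : 'End(g))
    (u : {vspace g}) (e0 : g) (mu : R) (v0 w0 : g) (D : 'End(g))
    (hlie : is_lie_bracket br)
    (hdim : \dim {:g} = (2 * n)%N)
    (hu : codim1_abelian_ideal br u)
    (hskt : skt br ip J)
    (he0 : ip e0 e0 = 1)
    (he0u : {in u, forall x, ip e0 x = 0})
    (hL : block_form br ip J u e0 mu v0 w0 D) :
  let a := Jcore J u in
  (exists (e : seq g) (ra rb : 'I_n.-1 -> R),
     normal_form_basis ip J a mu D e ra rb) /\
  forall (e : seq g) (ra rb : 'I_n.-1 -> R),
    normal_form_basis ip J a mu D e ra rb ->
    let case_i := v0 = 0 in
    let case_ii :=
      v0 <> 0 /\ (forall i, ra i = 0) /\ in_unitary ip J a D /\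
      singular_on a D /\ v0 \in lker D in
    [/\ harmonic br ip J <-> case_i \/ case_ii,
        ~ (case_i /\ case_ii),
        (forall i, ra i = 0) <-> in_unitary ip J a D &
        unimodular br ->
          (case_i ->
             (mu = 0 /\ in_unitary ip J a D) \/
             (mu <> 0 /\ exists! i, ra i = - (mu / 2))) /\
          (case_ii -> mu = 0)].
Proof.
move=> a; have [hJ dd0] := hskt.
have full_basis e : orthonormal_basis ip a e ->
    orthonormal_basis ip fullv [:: e0, J e0 & e].
  move=> be; apply: orthonormal_basis_cons => //; first exact: memvf.
  apply: orthonormal_basis_cons.
  - by rewrite mem_orthogonal_in memvf ipC (ip_J hJ) eqxx.
  - exact: (ip_e1 hJ).
  suff -> : orthogonal_in ip (orthogonal_in ip fullv e0) (J e0) = a by [].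
  apply/vspaceP => x; rewrite (mem_Jcore hu hJ he0 he0u) !mem_orthogonal_in memvf.
  by rewrite !(ipC _ x).
(* Blocks are read through [nth]; this length shows that they exhaust [e] and that the default value
   is never reached. The case [n = 0] is excluded by the two vectors [e0] and [J e0]. *)
have size_e e : orthonormal_basis ip a e -> size e = (2 * n.-1)%N.
  move=> /full_basis[/(@size_basis _ _ _ _ (in_tuple _))].
  by rewrite hdim /=; case: (n) => // m; rewrite mulnS => -[].
split.
  have [e [ra [rb [be eb]]]] := skt_normal_form hlie hu hJ he0 he0u hL dd0.
  exists e, (fun i => ra i), (fun i => rb i); split=> // i x y.
  have [|[[Jx Jy] Dx Dy] rai] := eb i; last by split.
  by rewrite (size_e e) // ltn_mul2l /=.
move=> e ra rb nf case_i case_ii; have be := nf.1.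
have [v0a _ Da Le1 _] := hL.
have raP i : ra i = 0 \/ ra i = - (mu / 2) by have [] := nf.2 i.
have DJa : {in a, forall x, D (J x) = J (D x)}.
  by move=> x; apply: (DJ hu hJ he0 he0u hL).
have unitaryE := unitary_normal_form nf (size_e e be) Da DJa.
(* The trace is moved from [f] to the adapted basis, where [e0] contributes 0, [e1] contributes
   [mu], and [e] the trace of [D]. *)
have tauE f : orthonormal_basis ip fullv f ->
    \sum_(v <- f) ip (br e0 v) v = mu + 2 * \sum_i ra i.
  move=> bf; rewrite (trace_orthonormal (br e0) bf).
  rewrite -(trace_orthonormal (br e0) (full_basis e be)) !big_cons /=.
  rewrite (br_e0e0 _ hlie) ip0l add0r Le1 !ipE (ip_e1 hJ he0).
  rewrite (ipC _ v0) (Jcore_ip hu hJ he0 he0u v0a).2 mulr1 addr0; congr (_ + _).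
  rewrite -(trace_normal_form nf (size_e e be)); apply: eq_big_seq => v ve.
  by rewrite (br_e0_Jcore hu hJ he0 he0u hL) // (basis_mem be.1).
have harmonicE : harmonic br ip J <-> D v0 = (2 * \sum_i ra i) *: v0.
  have E f (bf : orthonormal_basis ip fullv f) :=
    harmonic_basis hlie hu hJ he0 he0u hL bf.
  have tauB f (bf : orthonormal_basis ip fullv f) :
      \sum_(v <- f) ip (br e0 v) v - mu = 2 * \sum_i ra i.
    by rewrite tauE // addrC addKr.
  (* [harmonic] quantifies over all orthonormal bases, but by [tauB] the criterion is the same for
     each; the adapted basis provides an instance for the forward direction. *)
  split=> [har|Dv0 f bf]; last by apply/E; rewrite // tauB.
  have bF := full_basis e be.
  by rewrite -(tauB _ bF); apply/E => //; apply: har.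
have sumE := sum_real_parts raP.
set k := #|_| in sumE.
split=> //.
- split=> [/harmonicE Dv0|].
    have [|v0n0] := eqVneq v0 0; [by left | right].
    have ra0 : forall i, ra i = 0.
      apply: (real_parts_eq0 raP); rewrite -/k.
      have := skt_equation hlie hu hJ he0 he0u hL dd0 v0a v0a.
      have -> : D (D v0) = (2 * \sum_i ra i) *: ((2 * \sum_i ra i) *: v0).
        by rewrite Dv0 linearZ /= Dv0.
      rewrite Dv0 !ipE sumE => E.
      (* With t = - k mu the eigenvalue of [D] at [v0], the SKT equation at (v0, v0) is 2 t (mu + 2
         t) = 0 times the squared norm of [v0]. The factor 2 k - 1 is then excluded by parity. *)
      have kE : mu * mu * (k%:R * (2 * k%:R - 1)) = 0 :> R.
        apply: (mulIf (x := ip v0 v0)); first by rewrite ip_eq0.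
        lra.
      move/eqP: kE; rewrite !mulf_eq0 orbb => /or3P[/eqP ->|k0|]; [by left | | ].
        by right; apply/eqP; rewrite pnatr_eq0 in k0.
      rewrite subr_eq0 -natrM -[1]/(1%:R) eqr_nat => /eqP/(congr1 odd).
      by rewrite mul2n odd_double.
    have Dv00 : D v0 = 0 by rewrite Dv0 big1 // mulr0 scale0r.
    have v0k : v0 \in lker D by rewrite memv_ker Dv00.
    split; first exact/eqP.
    split=> //; split; first exact/unitaryE.
    split=> //; apply: contraNneq v0n0 => k0.
    by rewrite -memv0 -k0 memv_cap v0k.
  case=> [v00|[_ [ra0 [_ [_ v0k]]]]]; apply/harmonicE.
    by rewrite v00 linear0 scaler0.
  by rewrite big1 // mulr0 scale0r; apply/eqP; rewrite -memv_ker.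
- by case=> v00 [].
- move=> /(_ e0); rewrite -(trace_orthonormal (br e0) (full_basis e be)).
  rewrite (tauE _ (full_basis e be)) => tr0; split=> [_|[_ [ra0 _]]]; last first.
    by move: tr0; rewrite big1 // mulr0 addr0.
  have [mu0|mun0] := eqVneq mu 0.
    by left; split=> //; apply/unitaryE/(real_parts_eq0 raP); left.
  right; split; first exact/eqP.
  (* The trace of ad e0 is mu - k mu, and [mu] is nonzero. *)
  have k1 : k = 1%N.
    move: tr0; rewrite sumE => E; apply/eqP; rewrite -(eqr_nat R).
    by apply/eqP/(mulfI mun0); lra.
  have [i ki] := mem_card1 k1.
  (* As [mu] is nonzero, the indices with nonzero real part are exactly those with real part - mu /
     2. *)
  have raE j : (ra j = - (mu / 2)) <-> j = i.
    have := ki j; rewrite !inE => rj; split=> [raj|->].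
      apply/eqP; rewrite -rj raj oppr_eq0 mulf_neq0 // invr_eq0 pnatr_eq0 //.
    by case: (raP i) => // ri; have := ki i; rewrite !inE ri !eqxx.
  by exists i; split=> [|j /raE ->]; first exact/raE.
Qed.
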